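(* For each terminal $i\in[N_U]=\{1,\dots,N_U\}$, consider the problem $$\sup_{p_i\ge 0}\left\{\lambda_i\log\left(1+\frac{p_i\cdot h_i^2}{\sigma_i^2}\right)-\frac{\mu}{\varphi_i}(p_i-z_i)_+\right\}.$$ A parameterized optimal solution to this problem may be expressed as $$p_i^*(h_i)=\max\left\{\left(\frac{\lambda_i\varphi_i}{\mu}-\frac{\sigma_i^2}{h_i^2}\right)_+,\ (z_i)_+\right\},$$ whenever $\lambda_i$ and $\mu$ are not simultaneously zero; otherwise (that is, if $\lambda_i=\mu=0$) selecting $p_i^*=0$ is optimal.
   Context: Notation: $(x)_+=\max\{x,0\}$. There are $N_U$ terminals in a parallel, interference-free point-to-point communication network. For terminal $i$: $h_i\in\mathcal{H}$ is the realized fading coefficient ($\mathcal{H}$ being the set of possible fading values), $\sigma_i^2$ is the noise variance of the link, $p_i$ is the allocated power, $\varphi_i\in(0,1]$ is the confidence level of the Conditional Value-at-Risk $\mathrm{CVaR}^{\varphi_i}[\xi]=\inf_{z\in\mathbb{R}}\{z+\frac{1}{\varphi_i}\mathbb{E}[(\xi-z)_+]\}$ imposed on the power, and $z_i\in\mathbb{R}$ is the corresponding CVaR auxiliary variable. The numbers $\lambda_i\ge 0$ and $\mu\ge 0$ are Lagrange multipliers (of the rate constraint of terminal $i$ and of the total power constraint, respectively). In the problem, $h_i,\sigma_i^2,\varphi_i,z_i,\lambda_i,\mu$ are fixed and the optimization is over the scalar $p_i$ only. *)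

(* Defs.v *)
From HB Require Import structures.
From mathcomp Require Import all_boot all_order all_algebra.
From mathcomp Require Import all_classical all_reals all_analysis.

Set Implicit Arguments.
Unset Strict Implicit.
Unset Printing Implicit Defensive.

Import Order.TTheory GRing.Theory Num.Theory.
Import numFieldNormedType.Exports.

Local Open Scope classical_set_scope.
Local Open Scope ring_scope.

Definition power_objective (R : realType) (lam mu phi z h sigma p : R) : R :=
  lam * ln (1 + p * h ^+ 2 / sigma ^+ 2) - mu / phi * Num.max (p - z) 0.

Definition power_value (R : realType) (f : R -> R) : \bar R :=
  ereal_sup [set (f p)%:E | p in [set p : R | 0 <= p]].

(* Solutions live in [0, +oo]: when mu = 0 < lam and h != 0 the supremum is not
   attained by any real power and the closed form below is +oo.  A real solution
   attains the supremum; +oo is a solution when the supremum is the limit of the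
   objective as the power grows to +oo. *)
Definition power_optimal (R : realType) (f : R -> R) (p : \bar R) : Prop :=
  match p with
  | r%:E => 0 <= r /\ (f r)%:E = power_value f
  | +oo%E => (f q)%:E @[q --> +oo] --> power_value f
  | -oo%E => False
  end.

(* The divisions are those of the extended reals, where 0^-1 = +oo.
   When mu = 0 < lam and h = 0 the difference is +oo - +oo, which the library
   evaluates to -oo; the objective is then identically 0, so any power is optimal. *)
Definition power_star (R : realType) (lam mu phi z h sigma : R) : \bar R :=
  (maxe (maxe ((lam * phi)%:E / mu%:E - (sigma ^+ 2)%:E / (h ^+ 2)%:E) 0)
        (maxe z%:E 0))%E.

(* Main.v *)
Require Import Defs.
From mathcomp Require Import all_boot all_order all_algebra.
From mathcomp Require Import all_classical all_reals all_analysis.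
From mathcomp Require Import ring lra.

(** The objective is concave in the power.  Below [z] it is nondecreasing; above
    [z] its slope is [lam * a / (1 + p * a) - mu / phi], with
    [a = h ^+ 2 / sigma ^+ 2], which vanishes at the water level
    [lam * phi / mu - sigma ^+ 2 / h ^+ 2].  The tangent bound for [ln] at the
    candidate power turns this into global optimality, uniformly in [a >= 0] and
    [lam >= 0].  When [mu = 0 < lam] and [h != 0] there is no penalty and the
    objective diverges. *)

Import Order.TTheory GRing.Theory Num.Theory.
Local Open Scope classical_set_scope.
Local Open Scope ring_scope.

(** With [t = x / y - 1] this is [ln (1 + t) <= t]. *)
Lemma ln_tangent (R : realType) (x y : R) :
  0 < x -> 0 < y -> ln x <= ln y + (x - y) / y.
Proof.
move=> x0 y0; have xy0 : 0 < x / y by rewrite divr_gt0.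
have -> : (x - y) / y = x / y - 1 by rewrite mulrBl divff// gt_eqF.
have -> : ln x = ln y + ln (x / y).
  by rewrite -lnM ?posrE// mulrC divfK// gt_eqF.
rewrite lerD2l; have -> : ln (x / y) = ln (1 + (x / y - 1)) by rewrite addrC subrK.
by apply: le_ln1Dx; lra.
Qed.

Lemma power_optimal_max (R : realType) (f : R -> R) (r : R) :
  0 <= r -> (forall p, 0 <= p -> f p <= f r) -> power_optimal f r%:E.
Proof.
move=> r0 fr; split=> //; apply/eqP; rewrite eq_le; apply/andP; split.
  by apply: ereal_sup_ubound; exists r.
by apply: ge_ereal_sup => _ [p p0 <-]; rewrite lee_fin fr.
Qed.

Lemma power_optimal_pinfty (R : realType) (f : R -> R) :
  f q @[q --> +oo] --> +oo -> power_optimal f +oo%E.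
Proof.
move=> foo; rewrite /power_optimal.
suff -> : power_value f = +oo%E by exact/cvgeryP.
apply/eqyP => A _.
have [q [q0 Aq]] : exists q, 0 <= q /\ A <= f q.
  apply: (@filter_ex _ +oo); apply: filterI; first exact: nbhs_pinfty_ge.
  by move/cvgryPge : foo; apply.
apply: (@le_trans _ _ (f q)%:E); first by rewrite lee_fin.
by apply: ereal_sup_ubound; exists q.
Qed.

(** First-order optimality for a concave function with a kink at [z]. To the right of [r] the slope
    is nonpositive; to the left, either no admissible power remains, or the penalty is already zero,
    or the slope vanishes at [r]. *)
Lemma log_hinge_max (R : realType) (lam a c z r p : R) :
  0 <= lam -> 0 <= a -> 0 <= c -> 0 <= r -> z <= r ->
  lam * a <= c * (1 + r * a) ->
  [\/ r = 0, r = z | lam * a = c * (1 + r * a)] ->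
  0 <= p ->
  lam * ln (1 + p * a) - c * Num.max (p - z) 0 <=
  lam * ln (1 + r * a) - c * Num.max (r - z) 0.
Proof.
move=> lam0 a0 c0 r0 zr slope r_cases p0.
have pa1 : 0 < 1 + p * a by rewrite ltr_pwDl// mulr_ge0.
have ra1 : 0 < 1 + r * a by rewrite ltr_pwDl// mulr_ge0.
set s := lam * a / (1 + r * a).
have s_le : s <= c by rewrite ler_pdivrMr.
have tangent : lam * ln (1 + p * a) <= lam * ln (1 + r * a) + s * (p - r).
  have := ler_wpM2l lam0 (ln_tangent _ _ _ pa1 ra1).
  by congr (_ <= _); rewrite /s; field; rewrite gt_eqF.
have -> : Num.max (r - z) 0 = r - z by apply/max_idPl; lra.
(* Beyond [r] the penalty is linear with slope [c >= s], so it absorbs the gain allowed by the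
   tangent. *)
have [rp|pr] := leP r p.
  have -> : Num.max (p - z) 0 = p - z by apply/max_idPl; lra.
  have : s * (p - r) <= c * (p - r) by rewrite ler_wpM2r// subr_ge0.
  lra.
have maxl : p - z <= Num.max (p - z) 0 by rewrite le_max lexx.
have maxr : 0 <= Num.max (p - z) 0 by rewrite le_max lexx orbT.
case: r_cases => [r_eq0|r_eqz|slope_eq]; first by lra.
- have : lam * ln (1 + p * a) <= lam * ln (1 + r * a).
    rewrite ler_wpM2l// ler_ln ?posrE// lerD2l ler_wpM2r//; exact: ltW.
  have := mulr_ge0 c0 maxr; rewrite -r_eqz subrr mulr0; lra.
(* The tangent has slope [c] and is compared with the lower bound [p - z] of the hinge, valid on
   both sides of [z]. *)
- have sc : s = c by rewrite /s slope_eq mulfK// gt_eqF.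
  have : c * (p - z) <= c * Num.max (p - z) 0 by rewrite ler_wpM2l.
  move: tangent; rewrite sc; lra.
Qed.

(* The level [w] need not be the critical point when it is nonpositive; this
   covers [h = 0], where no critical point exists, with [w = 0]. *)
Lemma power_optimal_level (R : realType) (lam mu phi z h sigma w : R) :
  0 < phi -> 0 <= lam -> 0 <= mu ->
  let a := h ^+ 2 / sigma ^+ 2 in
  lam * a <= mu / phi * (1 + w * a) ->
  (0 < w -> lam * a = mu / phi * (1 + w * a)) ->
  power_optimal (power_objective lam mu phi z h sigma)
    (maxe (maxe w%:E 0) (maxe z%:E 0)).
Proof.
move=> phi0 lam0 mu0 a slope slope_eq; rewrite -!EFin_max.
set r := Num.max _ _.
have c0 : 0 <= mu / phi by rewrite divr_ge0// ltW.
have a0 : 0 <= a by rewrite divr_ge0 ?sqr_ge0.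
have wr : w <= r by rewrite !le_max lexx.
have zr : z <= r by rewrite !le_max lexx !orbT.
have r0 : 0 <= r by rewrite !le_max lexx !orbT.
apply: power_optimal_max => // p p0; rewrite /power_objective -(mulrA p) -(mulrA r) -/a.
apply: log_hinge_max => //.
  (* The slope bound passes from [w] to [r], as its right-hand side is nondecreasing in the
     level. *)
  by apply: (le_trans slope); rewrite ler_wpM2l// lerD2l ler_wpM2r.
have [r0'|rz|rw] : [\/ r = 0, r = z | r = w].
  by rewrite /r /Num.max; do 3?case: ifP => _;
    by [constructor 1|constructor 2|constructor 3].
- by constructor 1.
- by constructor 2.
have [w0|w0] := ltP 0 w; last by constructor 1; apply/le_anti; rewrite r0 rw w0.
by constructor 3; rewrite rw slope_eq.
Qed.

Lemma power_optimal_h0 (R : realType) (lam mu phi z sigma : R) :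
  0 < sigma -> 0 < phi -> 0 <= lam -> 0 <= mu ->
  power_optimal (power_objective lam mu phi z 0 sigma)
    (power_star lam mu phi z 0 sigma).
Proof.
move=> sigma0 phi0 lam0 mu0; rewrite /power_star [X in (_ - _ * X)%E]inver.
(* [sigma ^+ 2 / 0 = +oo] makes the difference [-oo] for every [mu]; its positive part [0] is then
   written [maxe 0 0] to fit the level [w = 0]. *)
rewrite expr0n/= eqxx gt0_muley ?lte_fin ?exprn_gt0// addeNy maxNye.
rewrite -{1}[0%E]maxxx.
apply: (power_optimal_level _ _ _ _ _ _ _ 0) => //; last by rewrite ltxx.
by rewrite expr0n/= !(mul0r, mulr0) addr0 mulr1 divr_ge0// ltW.
Qed.

(** With [mu] and [h] nonzero the water level is real and solves the first-order condition
    exactly. *)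
Lemma power_optimal_mu_gt0 (R : realType) (lam mu phi z h sigma : R) :
  0 < sigma -> 0 < phi -> 0 <= lam -> 0 < mu -> h != 0 ->
  power_optimal (power_objective lam mu phi z h sigma)
    (power_star lam mu phi z h sigma).
Proof.
move=> sigma0 phi0 lam0 mu0 h0.
rewrite /power_star !inver gt_eqF// sqrf_eq0 (negPf h0) -!EFinM -EFinB.
have slope : lam * (h ^+ 2 / sigma ^+ 2) =
  mu / phi * (1 + (lam * phi / mu - sigma ^+ 2 / h ^+ 2) * (h ^+ 2 / sigma ^+ 2)).
  by field; rewrite h0 !gt_eqF.
by apply: power_optimal_level; rewrite -?slope// ltW.
Qed.

Lemma power_optimal_mu0 (R : realType) (lam phi z h sigma : R) :
  0 < sigma -> 0 < phi -> 0 < lam -> h != 0 ->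
  power_optimal (power_objective lam 0 phi z h sigma)
    (power_star lam 0 phi z h sigma).
Proof.
move=> sigma0 phi0 lam0 h0.
rewrite /power_star !inver eqxx sqrf_eq0 (negPf h0).
(* [lam * phi / 0 = +oo] minus a finite term is [+oo], so the candidate is [+oo]. *)
rewrite gt0_muley ?lte_fin ?mulr_gt0// -EFinM -EFinN addye// !maxye.
apply: power_optimal_pinfty; apply/cvgryPge => A.
set a := h ^+ 2 / sigma ^+ 2.
have a0 : 0 < a by rewrite divr_gt0 ?exprn_even_gt0//= gt_eqF.
near=> q.
rewrite /power_objective !mul0r subr0 -(mulrA q) -/a mulrC -ler_pdivrMr//.
(* Any [q >= expR (A / lam) / a] brings the logarithm to at least [A / lam]. *)
have le_qa : expR (A / lam) <= q * a.
  by rewrite -ler_pdivrMr//; near: q; exact: nbhs_pinfty_ge.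
have e0 := expR_gt0 (A / lam).
by rewrite -[A / lam]expRK ler_ln ?posrE//; lra.
Unshelve. all: by end_near. Qed.

Theorem theorem1 (R : realType) (N : nat) (H : set R)
    (sigma phi z lam : 'I_N -> R) (mu : R)
    (sigma_gt0 : forall i, 0 < sigma i)
    (phi_gt0 : forall i, 0 < phi i) (phi_le1 : forall i, phi i <= 1)
    (lam_ge0 : forall i, 0 <= lam i) (mu_ge0 : 0 <= mu) :
  forall (i : 'I_N) (h : R), H h ->
    (~ (lam i = 0 /\ mu = 0) ->
       power_optimal
         (power_objective (lam i) mu (phi i) (z i) h (sigma i))
         (power_star (lam i) mu (phi i) (z i) h (sigma i))) /\
    (lam i = 0 /\ mu = 0 ->
       power_optimal
         (power_objective (lam i) mu (phi i) (z i) h (sigma i)) 0%:E).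
Proof.
move=> i h _; split=> [lam_mu|[lam0 mu0]]; last first.
  apply: power_optimal_max => // p _.
  by rewrite /power_objective lam0 mu0 !mul0r.
(* [h = 0] is settled for all [mu] at once; when [h != 0] and [mu = 0], excluding [lam i = mu = 0]
   leaves [0 < lam i], the divergent case. *)
have [->|h0] := eqVneq h 0; first exact: power_optimal_h0.
have [mu0|mu0] := ltP 0 mu; first exact: power_optimal_mu_gt0.
have mu_eq0 : mu = 0 by apply/le_anti; rewrite mu0.
rewrite mu_eq0; apply: power_optimal_mu0 => //.
by rewrite lt0r lam_ge0 andbT; apply/eqP => lam0; apply: lam_mu.
Qed.
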